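(* Let $Y_1(\mathcal D)$ and $Y_2(\mathcal D)$ be the two components of the graph $Y(\mathcal D)$ obtained from the Desargues graph $\mathcal D$ as described in the context. Then $Y_1(\mathcal D)$ and $Y_2(\mathcal D)$ are coherent $\{K_4,K_3\}_{K_2}$-ultrahomogeneous graphs composed by $5$ copies of $K_4$ and $10$ copies of $K_3$ not contained in a copy of $K_4$ each. Moreover, the $10$ vertices and the $10$ copies of $K_3$ not contained in a copy of $K_4$ in either graph constitute (as points and lines, respectively) the Desargues self-dual $(10_3)$ configuration, whose Levi graph is $\mathcal D$ and whose Menger graph is equal to both $Y_1(\mathcal D)$ and $Y_2(\mathcal D)$. Furthermore, both graphs are isomorphic to the line graph $L(K_5)$, whose complement is the Petersen graph.
   Context: **The graph $\mathcal D$.** The Desargues graph $\mathcal D$ is the cubic graph obtained from the $20$-cycle $(0,1,\ldots,19)$, whose vertices $4x,4x+1,4x+2,4x+3$ are renamed $x_0,x_1,x_2,x_3$ respectively ($x\in\mathbb Z_5$), by adding the edges $\{x_3,(x+2)_0\}$ and $\{x_1,(x+2)_2\}$ for $x\in\mathbb Z_5$ (operations mod $5$). **Oriented 6-cycles.** For $x\in\mathbb Z_5$ consider the oriented $6$-cycles of $\mathcal D$ (vertices listed in cyclic order): $A_x=(x_0\ x_1\ x_2\ x_3\ (x+1)_0\ (x+4)_3)$, $B_x=(x_1\ x_0\ (x+4)_3\ (x+4)_2\ (x+2)_1\ (x+2)_2)$, $C_x=(x_2\ x_1\ x_0\ (x+3)_3\ (x+3)_2\ (x+3)_1)$, $D_x=(x_0\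 (x+4)_3\ (x+1)_0\ (x+1)_1\ (x+3)_2\ (x+3)_3)$. These are orientations of the twenty $6$-cycles of $\mathcal D$ such that the two $6$-cycles sharing any given $2$-path traverse it in opposite directions. **The graph $Y(\mathcal D)$.** The square of an oriented $6$-cycle $(c_0\,c_1\ldots c_5)$ is the digraph on $\{c_0,\dots,c_5\}$ with arcs $(c_i,c_{i+2})$, $i\in\mathbb Z_6$; it consists of two disjoint oriented triangles. The graph $Y(\mathcal D)$ is obtained from the squares of the twenty oriented $6$-cycles above by cohering them along their pairs of oppositely oriented arcs, that is, by taking the union of each pair of opposite arcs $(u,v)$, $(v,u)$ (arising from the two opposite traversals of a common $2$-path) as one undirected edge $\{u,v\}$. It has two components, $Y_1(\mathcal D)$ (with vertices $x_0,x_2$, $x\in\mathbb Z_5$) and $Y_2(\mathcal D)$ (with vertices $x_1,x_3$, $x\in\mathbb Z_5$). **Ultrahomogeneity.** A graph $G$ is $H$-ultrahomogeneous ($H$-UH) if every isomorphism between two induced copies of $H$ in $G$ extends to an automorphism of $G$. Let $M$ be an induced subgraph of a graph $H$ and let $G$ be both $M$-UH and $H$-UH. Then $G$ is a (coherent) $\{H\}_M$-UH graph if, for each copy $H_0$ of $H$ induced in $G$ and containing a copy $M_0$ of $M$, there exists exactly one copy $H_1\neq H_0$ of $H$ induced in $G$ such that $V(H_0)\cap V(H_1)=V(M_0)$ and $E(H_0)\cap E(H_1)=E(M_0)$. If $G$ is coherent $\{H\}_M$-UH and $K$ is both a subgraph of $H$ and a supergraph of $M$, then $G$ is $\{K\not\subset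 H\}_M$-UH if every isomorphism between two induced copies of $K$ in $G$ not contained in any copy of $H$ in $G$ extends to an automorphism of $G$. If, under these conditions, each copy of $M$ induced in $G$ coincides with the intersection of exactly one copy of $H$ and exactly one copy of $K$ not contained in any copy of $H$, then $G$ is coherent $\{H,K\}_M$-UH. Here $H=K_4$, $K=K_3$, $M=K_2$. **Configurations.** The Levi graph of a configuration is the bipartite incidence graph of its points and lines. The Menger graph of a self-dual configuration has its points as vertices, any two of them determining an edge if and only if they are collinear in the configuration.
   Formalization: Coherent {K4,K3}_{K2}-UH is taken without the coherent {K4}_{K2}-UH requirement (a unique second K4 meeting each K4 in a given edge), which fails here since two copies of K4 share only one vertex; the other conditions are kept. *)

(* Defs.v *)
From HB Require Import structures.
From mathcomp Require Import all_boot all_algebra all_fingroup.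

Set Implicit Arguments.
Unset Strict Implicit.
Unset Printing Implicit Defensive.

Import GRing.Theory.

Record sgraph := SGraph {
  vert :> finType;
  adj : rel vert;
  adj_sym : symmetric adj;
  adj_irr : irreflexive adj }.

Definition isomorphic (G H : sgraph) : Prop :=
  exists f : G -> H, bijective f /\ forall x y, adj (f x) (f y) = adj x y.

Definition is_aut (G : sgraph) (g : {perm G}) : Prop :=
  forall x y, adj (g x) (g y) = adj x y.

Section Constructions.
Variables (G : sgraph) (S : {set G}).

Definition ind_vert := {x : G | x \in S}.
Definition ind_adj : rel ind_vert := fun x y => adj (val x) (val y).
Lemma ind_adj_sym : symmetric ind_adj.
Proof. by move=> x y; apply: adj_sym. Qed.
Lemma ind_adj_irr : irreflexive ind_adj.
Proof. by move=> x; apply: adj_irr. Qed.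
Definition induced : sgraph := SGraph ind_adj_sym ind_adj_irr.

Definition compl_adj : rel G := fun x y => (x != y) && ~~ adj x y.
Lemma compl_adj_sym : symmetric compl_adj.
Proof. by move=> x y; rewrite /compl_adj eq_sym adj_sym. Qed.
Lemma compl_adj_irr : irreflexive compl_adj.
Proof. by move=> x; rewrite /compl_adj eqxx. Qed.
Definition complement : sgraph := SGraph compl_adj_sym compl_adj_irr.

(* The edge set of the subgraph of G induced on S. *)
Definition edges_in : {set {set G}} :=
  [set e : {set G} |
    [exists x in S, exists y in S, adj x y && (e == [set x; y])]].
End Constructions.

Definition edges (G : sgraph) : {set {set G}} := edges_in [set: G].

Section LineGraph.
Variable G : sgraph.
Definition line_vert := {e : {set G} | e \in edges G}.
Definition line_adj : rel line_vert :=
  fun e f => (e != f) && (val e :&: val f != set0).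
Lemma line_adj_sym : symmetric line_adj.
Proof. by move=> e f; rewrite /line_adj eq_sym setIC. Qed.
Lemma line_adj_irr : irreflexive line_adj.
Proof. by move=> e; rewrite /line_adj eqxx. Qed.
Definition line_graph : sgraph := SGraph line_adj_sym line_adj_irr.
End LineGraph.

Section Complete.
Variable n : nat.
Definition complete_adj : rel 'I_n := fun i j => i != j.
Lemma complete_adj_sym : symmetric complete_adj.
Proof. by move=> i j; rewrite /complete_adj eq_sym. Qed.
Lemma complete_adj_irr : irreflexive complete_adj.
Proof. by move=> i; rewrite /complete_adj eqxx. Qed.
Definition complete : sgraph := SGraph complete_adj_sym complete_adj_irr.
End Complete.

Section Petersen.
Local Open Scope ring_scope.
(* (false, x) are the vertices of the outer pentagon, (true, x) those of the
   inner pentagram. *)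
Definition petersen_step (u v : bool * 'Z_5) : bool :=
  match u, v with
  | (false, x), (false, y) => y == x + 1
  | (true, x), (true, y) => y == x + 2
  | (false, x), (true, y) => y == x
  | (true, _), (false, _) => false
  end.
Definition petersen_adj : rel (bool * 'Z_5) :=
  fun u v => petersen_step u v || petersen_step v u.
Lemma petersen_adj_sym : symmetric petersen_adj.
Proof. by move=> u v; rewrite /petersen_adj orbC. Qed.
Lemma petersen_adj_irr : irreflexive petersen_adj.
Proof. by case=> [[] [[|[|[|[|[|x]]]]] hx]] //; vm_compute. Qed.
Definition petersen : sgraph := SGraph petersen_adj_sym petersen_adj_irr.
End Petersen.

Definition is_embedding (H G : sgraph) (f : {ffun H -> G}) : bool :=
  injectiveb f && [forall x, forall y, adj (f x) (f y) == adj x y].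

(* An induced copy of H in G is represented by its vertex set, its edge set
   being [edges_in A]. *)
Definition is_copy (H G : sgraph) (A : {set G}) : bool :=
  [exists f : {ffun H -> G}, is_embedding f && (f @: [set: H] == A)].

Definition free_copy (K H G : sgraph) (A : {set G}) : bool :=
  is_copy K A && ~~ [exists B : {set G}, is_copy H B && (A \subset B)].

(* Every isomorphism between two induced subgraphs of G whose vertex sets
   satisfy P extends to an automorphism of G; only the values of f on A
   matter. *)
Definition isos_extend (G : sgraph) (P : pred {set G}) : Prop :=
  forall (A B : {set G}) (f : G -> G), P A -> P B ->
    {in A &, injective f} -> f @: A = B ->
    {in A &, forall x y, adj (f x) (f y) = adj x y} ->
  exists g : {perm G}, is_aut g /\ {in A, g =1 f}.

Definition UH (H G : sgraph) : Prop := isos_extend (@is_copy H G).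

Definition is_induced_subgraph (M H : sgraph) : Prop :=
  exists f : M -> H, injective f /\ forall x y, adj (f x) (f y) = adj x y.

Definition is_subgraph (K H : sgraph) : Prop :=
  exists f : K -> H, injective f /\ forall x y, adj x y -> adj (f x) (f y).

(* The intersection of the subgraphs induced on A and B is the one induced
   on C. *)
Definition meets_in (G : sgraph) (A B C : {set G}) : Prop :=
  A :&: B = C /\ edges_in A :&: edges_in B = edges_in C.

Definition unique_intersection (H K M G : sgraph) : Prop :=
  forall M0 : {set G}, is_copy M M0 ->
    exists! HK : {set G} * {set G},
      [/\ is_copy H HK.1, free_copy K H HK.2 & meets_in HK.1 HK.2 M0].

(* The condition "for each copy H0 of H containing a copy M0 of M there is
   exactly one other copy H1 of H with H0 and H1 meeting in M0" defines
   one-graph {H}_M-coherence.  It is not a part of {H,K}_M-coherence below: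
   it contradicts [unique_intersection] (see [one_graph_incoherent]), the
   second copy through M0 being a copy of K instead of one of H. *)
Definition coherent2_UH (H K M G : sgraph) : Prop :=
  [/\ [/\ is_induced_subgraph M H, is_subgraph K H & is_subgraph M K],
      UH M G, UH H G,
      isos_extend (@free_copy K H G)
    & unique_intersection H K M G].

Definition one_graph_coherent (H M G : sgraph) : Prop :=
  forall H0 M0 : {set G}, is_copy H H0 -> is_copy M M0 -> M0 \subset H0 ->
    exists! H1 : {set G}, [/\ H1 != H0, is_copy H H1 & meets_in H0 H1 M0].

Lemma card_copy (H G : sgraph) (A : {set G}) : is_copy H A -> #|A| = #|H|.
Proof.
case/existsP=> f /andP[/andP[/injectiveP f_inj _] /eqP <-].
by rewrite card_imset // cardsT.
Qed.

Lemma edges_inI (G : sgraph) (A B : {set G}) :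
  edges_in A :&: edges_in B = edges_in (A :&: B).
Proof.
apply/setP=> e; rewrite !inE; apply/andP/existsP.
  case=> /existsP[x /andP[xA /existsP[y /and3P[yA xy /eqP De]]]].
  case/existsP=> z /andP[zB /existsP[t /and3P[tB _ /eqP Ee]]].
  have sub_eB u : u \in e -> u \in B by rewrite Ee !inE => /orP[]/eqP->.
  exists x; rewrite inE xA sub_eB ?De ?set21 //=.
  by apply/existsP; exists y; rewrite inE yA sub_eB ?De ?set22 // xy eqxx.
case=> x /andP[/setIP[xA xB] /existsP[y /and3P[/setIP[yA yB] xy De]]].
by split; apply/existsP; exists x; rewrite ?xA ?xB /=; apply/existsP;
  exists y; rewrite ?yA ?yB xy.
Qed.

Lemma one_graph_incoherent (G : sgraph) (M0 : {set G}) :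
  one_graph_coherent (complete 4) (complete 2) G ->
  unique_intersection (complete 4) (complete 3) (complete 2) G ->
  ~~ is_copy (complete 2) M0.
Proof.
move=> coh uni; apply/negP=> cM.
have [[H0 K0] [/= [cH0 cK0 [HK0 _]] uniq0]] := uni _ cM.
have sM0H0 : M0 \subset H0 by rewrite -HK0 subsetIl.
have [H1 [[neqH1 cH1 [H01 _]] _]] := coh _ _ cH0 cM sM0H0.
have sM0K : M0 \subset H1 :&: K0.
  by rewrite subsetI -{1}H01 -HK0 subsetIr subsetIr.
have HK1 : H1 :&: K0 = M0.
  apply/esym/eqP; rewrite eqEcard sM0K /= (card_copy cM) card_ord.
  case/andP: cK0 => cK nK; rewrite leqNgt; apply: contra nK => lt2.
  have HK : H1 :&: K0 = K0.
    by apply/eqP; rewrite eqEcard subsetIr (card_copy cK) card_ord.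
  by apply/existsP; exists H1; rewrite cH1 -HK subsetIl.
have [E] : (H0, K0) = (H1, K0).
  by apply: uniq0; split=> //; split=> //=; rewrite edges_inI HK1.
by rewrite E eqxx in neqH1.
Qed.

Definition composed_of (G : sgraph) (P : pred {set G}) : Prop :=
  \bigcup_(A | P A) A = [set: G] /\ \bigcup_(A | P A) edges_in A = edges G.

Record config := Config {
  point : finType;
  line : finType;
  inc : point -> line -> bool }.

Definition config_iso (C D : config) : Prop :=
  exists (f : point C -> point D) (g : line C -> line D),
    [/\ bijective f, bijective g & forall p l, inc (f p) (g l) = inc p l].

Definition dual (C : config) : config :=
  @Config (line C) (point C) (fun l p => inc p l).

Definition self_dual (C : config) : Prop := config_iso C (dual C).

(* A (v_r) configuration: v points and v lines, r points on each line, r lines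
   through each point, at most one line through two points. *)
Definition is_vr_config (v r : nat) (C : config) : Prop :=
  [/\ #|point C| = v, #|line C| = v,
      forall l : line C, #|[set p | inc p l]| = r,
      forall p : point C, #|[set l | inc p l]| = r
    & forall p q : point C, p != q ->
        #|[set l | inc p l && inc q l]| <= 1].

Section Levi.
Variable C : config.
Definition levi_adj : rel (point C + line C) := fun u v =>
  match u, v with
  | inl p, inr l | inr l, inl p => inc p l
  | _, _ => false
  end.
Lemma levi_adj_sym : symmetric levi_adj.
Proof. by do 2!case=> ?. Qed.
Lemma levi_adj_irr : irreflexive levi_adj.
Proof. by case. Qed.
Definition levi_graph : sgraph := SGraph levi_adj_sym levi_adj_irr.

Definition menger_adj : rel (point C) :=
  fun p q => (p != q) && [exists l, inc p l && inc q l].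
Lemma menger_adj_sym : symmetric menger_adj.
Proof.
by move=> p q; rewrite /menger_adj eq_sym; under eq_existsb do rewrite andbC.
Qed.
Lemma menger_adj_irr : irreflexive menger_adj.
Proof. by move=> p; rewrite /menger_adj eqxx. Qed.
Definition menger_graph : sgraph := SGraph menger_adj_sym menger_adj_irr.
End Levi.

(* The configuration of Desargues' theorem.  Triangles VertA 0 1 2 and
   VertB 0 1 2 are in perspective from Centre; Ray i joins VertA i and VertB i;
   SideA i and SideB i are the sides opposite to VertA i and VertB i; they meet
   in Axial i, and the three points Axial i lie on Axis. *)
Inductive desargues_point :=
  Centre | VertA of 'I_3 | VertB of 'I_3 | Axial of 'I_3.
Inductive desargues_line :=
  Axis | Ray of 'I_3 | SideA of 'I_3 | SideB of 'I_3.

Definition code_point (p : desargues_point) : unit + 'I_3 + 'I_3 + 'I_3 :=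
  match p with
  | Centre => inl (inl (inl tt)) | VertA i => inl (inl (inr i))
  | VertB i => inl (inr i) | Axial i => inr i
  end.
Definition decode_point (c : unit + 'I_3 + 'I_3 + 'I_3) : desargues_point :=
  match c with
  | inl (inl (inl _)) => Centre | inl (inl (inr i)) => VertA i
  | inl (inr i) => VertB i | inr i => Axial i
  end.
Lemma code_pointK : cancel code_point decode_point.
Proof. by case. Qed.
HB.instance Definition _ :=
  Countable.copy desargues_point (can_type code_pointK).
HB.instance Definition _ : isFinite desargues_point :=
  CanIsFinite code_pointK.

Definition code_line (l : desargues_line) : unit + 'I_3 + 'I_3 + 'I_3 :=
  match l with
  | Axis => inl (inl (inl tt)) | Ray i => inl (inl (inr i))
  | SideA i => inl (inr i) | SideB i => inr i
  end.
Definition decode_line (c : unit + 'I_3 + 'I_3 + 'I_3) : desargues_line :=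
  match c with
  | inl (inl (inl _)) => Axis | inl (inl (inr i)) => Ray i
  | inl (inr i) => SideA i | inr i => SideB i
  end.
Lemma code_lineK : cancel code_line decode_line.
Proof. by case. Qed.
HB.instance Definition _ :=
  Countable.copy desargues_line (can_type code_lineK).
HB.instance Definition _ : isFinite desargues_line :=
  CanIsFinite code_lineK.

Definition desargues_inc (p : desargues_point) (l : desargues_line) : bool :=
  match p, l with
  | Centre, Ray _ => true
  | VertA j, Ray i | VertB j, Ray i => j == i
  | VertA j, SideA i | VertB j, SideB i => j != i
  | Axial j, SideA i | Axial j, SideB i => j == i
  | Axial _, Axis => true
  | _, _ => false
  end.

Definition desargues_config : config := Config desargues_inc.

(* Points: the vertices of G; lines: the copies of K_3 in no copy of K_4. *)
Definition triangle_config (G : sgraph) : config :=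
  @Config G {A : {set G} | free_copy (complete 3) (complete 4) A}
    (fun x A => x \in val A).

Section Desargues.
Local Open Scope ring_scope.

(* (x, i) is the vertex x_i. *)
Definition dvert : finType := ('Z_5 * 'I_4)%type.

(* The position 4x + i of x_i in the 20-cycle (0, 1, ..., 19). *)
Definition pos (u : dvert) : nat := (4 * u.1 + u.2)%N.

Definition desargues_step (u v : dvert) : bool :=
  [|| pos v == ((pos u).+1 %% 20)%N,
      (u.2 == 3) && (v == (u.1 + 2, 0))
    | (u.2 == 1) && (v == (u.1 + 2, 2))].

Definition desargues_adj : rel dvert :=
  fun u v => desargues_step u v || desargues_step v u.
Lemma desargues_adj_sym : symmetric desargues_adj.
Proof. by move=> u v; rewrite /desargues_adj orbC. Qed.
Lemma desargues_adj_irr : irreflexive desargues_adj.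
Proof.
by case=> [[[|[|[|[|[|x]]]]] hx] [[|[|[|[|i]]]] hi]] //; vm_compute.
Qed.
Definition desargues_graph : sgraph :=
  SGraph desargues_adj_sym desargues_adj_irr.

Definition hexA (x : 'Z_5) : seq dvert :=
  [:: (x, 0); (x, 1); (x, 2); (x, 3); (x + 1, 0); (x + 4, 3)].
Definition hexB (x : 'Z_5) : seq dvert :=
  [:: (x, 1); (x, 0); (x + 4, 3); (x + 4, 2); (x + 2, 1); (x + 2, 2)].
Definition hexC (x : 'Z_5) : seq dvert :=
  [:: (x, 2); (x, 1); (x, 0); (x + 3, 3); (x + 3, 2); (x + 3, 1)].
Definition hexD (x : 'Z_5) : seq dvert :=
  [:: (x, 0); (x + 4, 3); (x + 1, 0); (x + 1, 1); (x + 3, 2); (x + 3, 3)].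

Definition hexagons : seq (seq dvert) :=
  [seq h x | h <- [:: hexA; hexB; hexC; hexD],
             x <- [:: 0; 1; 2; 3; 4] : seq 'Z_5].

(* (u, v) is an arc of the square of the oriented cycle c. *)
Definition square_arc (c : seq dvert) (u v : dvert) : bool :=
  (u \in c) && (v == next c (next c u)).

(* The arcs (u, v) of the square of c and (v, u) of the square of d come from
   opposite traversals of the same 2-path u - w - v. *)
Definition cohere (c d : seq dvert) (u v : dvert) : bool :=
  [&& c != d, square_arc c u v, square_arc d v u & next c u == next d v].

Definition Y_adj : rel dvert :=
  fun u v => has (fun c => has (fun d => cohere c d u v) hexagons) hexagons.
Lemma Y_adj_sym : symmetric Y_adj.
Proof.
suff sym u v : Y_adj u v -> Y_adj v u by move=> u v; apply/idP/idP; apply: sym.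
case/hasP=> c cH /hasP[d dH /and4P[cd uv vu e]].
apply/hasP; exists d => //; apply/hasP; exists c => //.
by rewrite /cohere eq_sym cd uv vu eq_sym e.
Qed.
Lemma Y_adj_irr : irreflexive Y_adj.
Proof.
by case=> [[[|[|[|[|[|x]]]]] hx] [[|[|[|[|i]]]] hi]] //; vm_compute.
Qed.
Definition Y_graph : sgraph := SGraph Y_adj_sym Y_adj_irr.

Definition Y1_verts : {set Y_graph} :=
  [set u : dvert | (u.2 == 0) || (u.2 == 2)].
Definition Y2_verts : {set Y_graph} :=
  [set u : dvert | (u.2 == 1) || (u.2 == 3)].

Definition Y1 : sgraph := induced Y1_verts.
Definition Y2 : sgraph := induced Y2_verts.

End Desargues.

Definition components (G : sgraph) : {set {set G}} :=
  equivalence_partition (connect (@adj G)) [set: G].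

(* Main.v *)
(* Y_1 and Y_2 are the two halves of the distance-2 graph of the bipartite graph
   D.  Label the vertices of D by 2-subsets of Z_5 so that both sides carry
   every label once and two vertices are adjacent iff they lie on different
   sides and their labels are disjoint; then two vertices are adjacent in Y(D)
   iff they lie on one side and their labels are distinct and meet, so both
   halves are L(K_5).

   In L(K_5) the copies of K_4 are the five stars, the free copies of K_3 are
   the triangles of K_5, and permutations of Z_5 act by automorphisms.  The
   triangle on a 3-set T is the set of the edges disjoint from the edge ~: T,
   i.e. the neighbourhood of that edge in the Petersen graph.  Hence points and
   lines of the triangle configuration are both indexed by the 2-subsets of
   Z_5, with disjointness as incidence. *)

Require Import Defs.
From mathcomp Require Import all_boot all_fingroup all_solvable all_algebra.

Set Implicit Arguments.
Unset Strict Implicit.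
Unset Printing Implicit Defensive.

(** * Isomorphisms of graphs and of configurations, and what they preserve *)

Lemma isomorphic_sym (G H : sgraph) : isomorphic G H -> isomorphic H G.
Proof.
case=> f [[g fK gK] fE]; exists g; split; first by exists f.
by move=> x y; rewrite -fE !gK.
Qed.

Lemma isomorphic_trans (G H K : sgraph) :
  isomorphic G H -> isomorphic H K -> isomorphic G K.
Proof.
case=> f [bf fE] [g [bg gE]]; exists (g \o f); split; first exact: bij_comp.
by move=> x y /=; rewrite gE fE.
Qed.

Lemma isomorphic_complement (G H : sgraph) :
  isomorphic G H -> isomorphic (complement G) (complement H).
Proof.
case=> f [bf fE]; exists f; split=> // x y.
by rewrite /= /compl_adj fE (inj_eq (bij_inj bf)).
Qed.

Lemma config_iso_sym (C D : config) : config_iso C D -> config_iso D C.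
Proof.
case=> f [g [[f' fK f'K] [g' gK g'K] incE]].
exists f', g'; split; [by exists f | by exists g | move=> p l].
by rewrite -incE f'K g'K.
Qed.

Lemma config_iso_trans (C D E : config) :
  config_iso C D -> config_iso D E -> config_iso C E.
Proof.
case=> f [g [bf bg incE]] [f' [g' [bf' bg' incE']]].
exists (f' \o f), (g' \o g); split; try exact: bij_comp.
by move=> p l /=; rewrite incE'.
Qed.

Lemma config_iso_dual (C D : config) :
  config_iso C D -> config_iso (dual C) (dual D).
Proof.
by case=> f [g [bf bg incE]]; exists g, f; split=> // l p; apply: incE.
Qed.

Lemma levi_graph_iso (C D : config) :
  config_iso C D -> isomorphic (levi_graph C) (levi_graph D).
Proof.
case=> f [g [[f' fK f'K] [g' gK g'K] incE]].
exists (fun u => match u with inl p => inl (f p) | inr l => inr (g l) end).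
split; last by case=> u [] v; rewrite /= ?incE.
exists (fun u => match u with inl p => inl (f' p) | inr l => inr (g' l) end).
  by case=> u; rewrite ?fK ?gK.
by case=> u; rewrite ?f'K ?g'K.
Qed.

Lemma card_bij_preim (S T : finType) (f : S -> T) (P : pred S) (Q : pred T) :
  bijective f -> (forall x, Q (f x) = P x) ->
  #|[set x | P x]| = #|[set y | Q y]|.
Proof.
move=> bf QP; rewrite -(card_imset _ (bij_inj bf)); apply: eq_card => y.
have [g _ gK] := bf; rewrite -[y]gK mem_imset; last exact: bij_inj.
by rewrite !inE QP.
Qed.

Lemma is_vr_config_iso (v r : nat) (C D : config) :
  config_iso C D -> is_vr_config v r C -> is_vr_config v r D.
Proof.
case=> f [g [bf bg incE]] [cP cL rL rP uP].
have [f' fK f'K] := bf; have [g' gK g'K] := bg.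
split=> [|| l | p | p q pq].
- by rewrite -(bij_eq_card bf).
- by rewrite -(bij_eq_card bg).
- rewrite -(rL (g' l)); symmetry; apply: (card_bij_preim bf) => p.
  by rewrite -incE g'K.
- rewrite -(rP (f' p)); symmetry; apply: (card_bij_preim bg) => l.
  by rewrite -incE f'K.
apply: leq_trans (uP (f' p) (f' q) _); last first.
  by rewrite (inj_eq (can_inj f'K)).
rewrite (card_bij_preim bg (Q := fun l => inc p l && inc q l)) // => l.
by rewrite -!incE !f'K.
Qed.

(** The lines are the vertex neighbourhoods, indexed by their centres. Applied to the Petersen
    graph, this gives the Desargues configuration; since adjacency is symmetric, the identity maps
    realise self-duality. *)
Definition nbhd_config (G : sgraph) : config := @Config G G (@adj G).

Lemma nbhd_config_iso (G H : sgraph) :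
  isomorphic G H -> config_iso (nbhd_config G) (nbhd_config H).
Proof. by case=> f [bf fE]; exists f, f. Qed.

Lemma nbhd_config_self_dual (G : sgraph) : self_dual (nbhd_config G).
Proof.
exists id, id; split; [by exists id | by exists id | move=> p l].
exact: (@adj_sym G).
Qed.

Lemma self_dual_iso (C D : config) :
  config_iso C D -> self_dual D -> self_dual C.
Proof.
move=> CD DD; apply: config_iso_trans (CD) _; apply: config_iso_trans DD _.
exact/config_iso_dual/config_iso_sym.
Qed.

(** * Complete graphs and cliques *)

Lemma sub_complete (m n : nat) :
  m <= n -> is_induced_subgraph (complete m) (complete n).
Proof.
move=> le_mn; exists (widen_ord le_mn); split=> // i j [ij].
exact/val_inj.
Qed.

Lemma induced_is_subgraph (M H : sgraph) :
  is_induced_subgraph M H -> is_subgraph M H.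
Proof. by case=> f [inj fE]; exists f; split=> // x y; rewrite fE. Qed.

Definition clique (G : sgraph) (A : {set G}) : Prop :=
  {in A &, forall x y, x != y -> adj x y}.

(** This trades embeddings for a cardinality and a clique condition; conversely, any enumeration of
    a clique is an embedding. *)
Lemma is_copy_complete (G : sgraph) (n : nat) (A : {set G}) :
  is_copy (complete n) A <-> #|A| = n /\ clique A.
Proof.
split=> [cA | [<- clA]].
  split; first by rewrite (card_copy cA) card_ord.
  case/existsP: cA => f /andP[/andP[/injectiveP f_inj /forallP fE] /eqP <-].
  move=> _ _ /imsetP[i _ ->] /imsetP[j _ ->]; rewrite (inj_eq f_inj) => ij.
  by rewrite (eqP (forallP (fE i) j)).
apply/existsP; exists [ffun i => enum_val i]; apply/andP; split.
  apply/andP; split.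
    by apply/injectiveP=> i j; rewrite !ffunE => /enum_val_inj.
  apply/forallP=> i; apply/forallP=> j; rewrite !ffunE /= /complete_adj.
  have [->|ij] := eqVneq i j; first by rewrite adj_irr.
  by rewrite clA ?enum_valP // (inj_eq enum_val_inj).
apply/eqP/setP=> x; apply/imsetP/idP=> [[i _ ->]|xA].
  by rewrite ffunE enum_valP.
by exists (enum_rank_in xA x); rewrite ?inE // ffunE enum_rankK_in.
Qed.

Lemma mem_edges_complete (n : nat) (S : {set complete n}) :
  (S \in edges (complete n)) = (#|S| == 2).
Proof.
rewrite inE; apply/existsP/cards2P=> [[x] | [x [y [xy ->]]]].
  by case/andP=> _ /existsP[y /and3P[_ xy /eqP ->]]; exists x, y.
by exists x; rewrite inE; apply/existsP; exists y; rewrite inE eqxx andbT.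
Qed.

(** The symmetric group on [T] is transitive on duplicate-free tuples of each length up to
    [#|T|]. *)
Lemma perm_extends_seq (T : finType) (s t : seq T) :
  uniq s -> uniq t -> size s = size t -> exists p : {perm T}, map p s = t.
Proof.
move=> us ut sz.
have le_sT : size s <= #|T| by rewrite -(card_uniqP us) max_card.
have tr := ntransitive_weak le_sT (Sym_trans T).
have Es : size s == size s by []; have Et : size t == size s by rewrite sz.
have sD : Tuple Es \in (size s).-dtuple([set: T]).
  by rewrite inE us; apply/subsetP=> i; rewrite inE.
have tD : Tuple Et \in (size s).-dtuple([set: T]).
  by rewrite inE ut; apply/subsetP=> i; rewrite inE.
have [p _ /(congr1 val) /= ->] := atransP2 tr sD tD.
by exists p.
Qed.

(** * Two-element sets *)

Section SetPairs.
Variable T : finType.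
Implicit Types a b c d : T.

Lemma disjoint_set2 a b c d :
  ([set a; b] :&: [set c; d] == set0)
    = ~~ [|| a == c, a == d, b == c | b == d].
Proof.
apply/eqP/idP=> [E | ].
  have /setP Ea := E; move: (Ea a) (Ea b); rewrite !inE !eqxx /= orbT.
  by case: (a == c); case: (a == d); case: (b == c); case: (b == d).
rewrite !negb_or => /and4P[ac ad bc bd]; apply/setP=> i; rewrite !inE.
by apply/andP=> -[/orP[]/eqP-> /orP[]]; apply/negP.
Qed.

Lemma eq_set2 a b c d :
  ([set a; b] == [set c; d])
    = (a == c) && (b == d) || (a == d) && (b == c).
Proof.
apply/eqP/idP=> [/setP E | ]; last first.
  by case/orP=> /andP[/eqP-> /eqP->] //; rewrite setUC.
move: (E a) (E b) (E c) (E d); rewrite !inE !eqxx /= !orbT.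
by rewrite ![c == _]eq_sym ![d == _]eq_sym;
  case: (a == c); case: (a == d); case: (b == c); case: (b == d).
Qed.

Lemma set2_at (S : {set T}) a :
  #|S| = 2 -> a \in S -> exists2 b, b != a & S = [set a; b].
Proof.
move/eqP/cards2P=> [b [c [bc ->]]]; rewrite !inE => /orP[]/eqP->.
  by exists c; rewrite // eq_sym.
by exists b; rewrite // setUC.
Qed.

Lemma imset_set2 (U : finType) (h : T -> U) a b :
  h @: [set a; b] = [set h a; h b].
Proof. by rewrite imsetU !imset_set1. Qed.

Lemma card_set3 a b c : uniq [:: a; b; c] -> #|[set a; b; c]| = 3.
Proof.
rewrite /= !inE negb_or andbT => /andP[/andP[ab ac] bc].
by rewrite -setUA cardsU1 cards2 !inE negb_or ab ac bc.
Qed.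
End SetPairs.

(** * Cliques, symmetries and triangles in a graph isomorphic to L(K_5) *)

Section LineGraphK5.
Variables (G : sgraph) (f : G -> line_graph (complete 5)).
Hypothesis f_bij : bijective f.
Hypothesis f_adj : forall x y, adj (f x) (f y) = adj x y.

(** The label of a vertex: the edge of K_5 that [f] assigns to it. *)
Let e (x : G) : {set 'I_5} := val (f x).

Lemma card_edge x : #|e x| = 2.
Proof. by apply/eqP; rewrite -mem_edges_complete (valP (f x)). Qed.

Lemma card_edgeC x : #|~: e x| = 3.
Proof. by rewrite cardsCs setCK card_ord card_edge. Qed.

Lemma edge_inj : injective e.
Proof. exact: inj_comp val_inj (bij_inj f_bij). Qed.

Lemma edge_surj (S : {set 'I_5}) : #|S| = 2 -> exists x, e x = S.
Proof.
move/eqP; rewrite -(@mem_edges_complete 5) => SE; have [g fK gK] := f_bij.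
by exists (g (Sub S SE)); rewrite /e gK SubK.
Qed.

Lemma edge_surj2 a b : a != b -> exists x, e x = [set a; b].
Proof. by move=> ab; apply: edge_surj; rewrite cards2 ab. Qed.

Lemma adj_edge x y : adj x y = (x != y) && (e x :&: e y != set0).
Proof. by rewrite -f_adj /= /line_adj (inj_eq (bij_inj f_bij)). Qed.

Lemma compl_adj_edge x y : compl_adj x y = (e x :&: e y == set0).
Proof.
rewrite /compl_adj adj_edge; case: eqVneq => [<- /=|_]; last exact: negbK.
by rewrite setIid -cards_eq0 card_edge.
Qed.

(** A normal form for adjacent vertices: their common end [a] comes first, and [b], [c] differ
    because labels are injective. *)
Lemma adj_edge_at x y : adj x y ->
  exists a b c, [/\ uniq [:: a; b; c], e x = [set a; b] & e y = [set a; c]].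
Proof.
rewrite adj_edge => /andP[xy /set0Pn[a /setIP[ax ay]]].
have [b ba xE] := set2_at (card_edge x) ax.
have [c ca yE] := set2_at (card_edge y) ay.
exists a, b, c; split=> //.
rewrite /= !inE negb_or ![a == _]eq_sym ba ca /= andbT.
by apply: contra xy => /eqP bc; rewrite -(inj_eq edge_inj) xE yE bc.
Qed.

Definition star (a : 'I_5) : {set G} := [set x | a \in e x].
Definition triangle (q : G) : {set G} := [set x | compl_adj x q].

Lemma mem_triangle x q : (x \in triangle q) = (e x \subset ~: e q).
Proof. by rewrite inE compl_adj_edge setI_eq0 disjoints_subset. Qed.

(** An edge at [a] is determined by its other end, one of the four remaining points. *)
Lemma card_star a : #|star a| = 4.
Proof.
rewrite -(card_imset _ edge_inj).
have -> : e @: star a = (fun b => [set a; b]) @: [set~ a].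
  apply/setP=> S; apply/imsetP/imsetP=> [[x] | [b]].
    rewrite inE => ax ->; have [b ba xE] := set2_at (card_edge x) ax.
    by exists b; rewrite // !inE.
  rewrite !inE => ba ->.
  have [|x xE] := @edge_surj2 a b; first by rewrite eq_sym.
  by exists x; rewrite // inE xE set21.
rewrite card_in_imset ?cardsC1 ?card_ord // => b c; rewrite !inE => ba ca /eqP.
by rewrite eq_set2 eqxx /= (negPf ba) andbF orbF => /eqP.
Qed.

Lemma card_triangle q : #|triangle q| = 3.
Proof.
have -> : 3 = #|[set S : {set 'I_5} | S \subset ~: e q & #|S| == 2]|.
  by rewrite cards_draws card_edgeC.
rewrite -(card_imset _ edge_inj); apply: eq_card => S; rewrite inE.
apply/imsetP/andP=> [[x xq ->] | [Sq /eqP/edge_surj[x xE]]].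
  by rewrite -mem_triangle xq card_edge.
by exists x; rewrite // mem_triangle xE.
Qed.

Lemma star_clique a : clique (star a).
Proof.
move=> x y; rewrite !inE => ax ay xy; rewrite adj_edge xy.
by apply/set0Pn; exists a; rewrite inE ax.
Qed.

(** Two disjoint pairs do not fit into a three-element set. *)
Lemma triangle_clique q : clique (triangle q).
Proof.
move=> x y; rewrite !mem_triangle => xq yq xy; rewrite adj_edge xy.
apply: contraTN (isT) => /eqP xy0.
have /subset_leq_card : e x :|: e y \subset ~: e q by rewrite subUset xq.
by rewrite cardsU xy0 cards0 !card_edge card_edgeC.
Qed.

(** Pairwise meeting two-element sets share a point or lie in a common three-element set. If ab and
    ac are members and some member misses [a], that member must be bc, and this confines all the
    others to abc. *)
Lemma clique_sub (A : {set G}) : clique A -> 1 < #|A| ->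
  (exists a, A \subset star a) \/ (exists q, A \subset triangle q).
Proof.
move=> clA /card_gt1P[x [y [xA yA xy]]].
have [a [b [c [abc xE yE]]]] := adj_edge_at (clA x y xA yA xy).
have [|/subsetPn[z zA]] := boolP (A \subset star a); first by left; exists a.
rewrite inE => az; right.
have neq u v i : i \in e u -> i \notin e v -> u != v.
  by move=> iu; apply: contraNneq => <-.
have meet u v : u \in A -> v \in A -> u != v -> e u :&: e v != set0.
  by move=> uA vA uv; have := clA u v uA vA uv; rewrite adj_edge uv.
have zx : z != x by rewrite eq_sym (@neq _ _ a) // xE set21.
have zy : z != y by rewrite eq_sym (@neq _ _ a) // yE set21.
have bz : b \in e z.
  have /set0Pn[i] := meet z x zA xA zx.
  rewrite xE !inE => /andP[iz /orP[]/eqP Ei]; last by rewrite -Ei.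
  by rewrite Ei (negPf az) in iz.
have cz : c \in e z.
  have /set0Pn[i] := meet z y zA yA zy.
  rewrite yE !inE => /andP[iz /orP[]/eqP Ei]; last by rewrite -Ei.
  by rewrite Ei (negPf az) in iz.
have zE : e z = [set b; c].
  apply/esym/eqP; rewrite eqEcard card_edge cards2 subUset !sub1set bz cz.
  by move: abc; rewrite /= !inE andbT => /andP[_ ->].
have [|q qE] := @edge_surj (~: [set a; b; c]).
  by rewrite cardsCs setCK card_ord card_set3.
(* An end [i] of [w] outside abc would force the other end [j] into each of ab, ac and bc, which
   have no common point. *)
exists q; apply/subsetP=> w wA; rewrite mem_triangle qE setCK.
apply/subsetP=> i iw; apply: contraT => iabc.
have [j _ wE] := set2_at (card_edge w) iw.
move: iabc; rewrite !inE !negb_or -andbA => /and3P[ia ib ic].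
have m u k l : u \in A -> e u = [set k; l] -> i != k -> i != l ->
    (j == k) || (j == l).
  move=> uA uE ik il; have := meet w u wA uA.
  rewrite (@neq _ _ i) //; last by rewrite uE !inE negb_or ik.
  by move/(_ isT); rewrite wE uE disjoint_set2 negbK (negPf ik) (negPf il).
move: (m x a b xA xE ia ib) (m y a c yA yE ia ic) (m z b c zA zE ib ic) abc.
rewrite /= !inE.
by case/orP=> /eqP->; rewrite ?eqxx ?[b == a]eq_sym;
  case: (a == b); case: (a == c); case: (b == c).
Qed.

Lemma K4_copyP (A : {set G}) :
  is_copy (complete 4) A <-> exists a, A = star a.
Proof.
split=> [/is_copy_complete[cA clA] | [a ->]]; last first.
  by apply/is_copy_complete; split; [apply: card_star | apply: star_clique].
have cA1 : 1 < #|A| by rewrite cA.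
case: (clique_sub clA cA1) => [[a sA] | [q /subset_leq_card]].
  by exists a; apply/eqP; rewrite eqEcard sA cA card_star.
by rewrite cA card_triangle.
Qed.

(** Of the three points off [e q], at least two differ from [a]; the edge joining them lies in the
    triangle but misses [a]. *)
Lemma triangle_not_sub_star q a : ~~ (triangle q \subset star a).
Proof.
have /card_gt1P[i [j [iS jS ij]]] : 1 < #|~: e q :\ a|.
  have := cardsD1 a (~: e q); rewrite card_edgeC.
  by case: (a \in _) #|_ :\ _| => [] [|[|n]].
have [x xE] := edge_surj2 ij; apply/subsetPn; exists x.
  rewrite mem_triangle xE; apply/subsetP=> k; rewrite !inE => /orP[]/eqP->.
    by move: iS; rewrite !inE => /andP[].
  by move: jS; rewrite !inE => /andP[].
move: iS jS; rewrite !inE xE !inE ![_ == a]eq_sym negb_or.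
by case/andP=> -> _ /andP[-> _].
Qed.

Lemma free_K3P (A : {set G}) :
  free_copy (complete 3) (complete 4) A <-> exists q, A = triangle q.
Proof.
split=> [/andP[/is_copy_complete[cA clA] nA] | [q ->]].
  have cA1 : 1 < #|A| by rewrite cA.
  case: (clique_sub clA cA1) => [[a sA] | [q sA]].
    case/existsP: nA; exists (star a); rewrite sA andbT.
    by apply/K4_copyP; exists a.
  by exists q; apply/eqP; rewrite eqEcard sA cA card_triangle.
apply/andP; split.
  apply/is_copy_complete.
  by split; [apply: card_triangle | apply: triangle_clique].
apply/existsP=> -[B /andP[/K4_copyP[a ->]]].
exact/negP/triangle_not_sub_star.
Qed.

(** For [a != b], an edge from [a] to a third point [c] separates the two stars. *)
Lemma star_inj : injective star.
Proof.
move=> a b /setP E; apply/eqP/contraT=> ab.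
have /card_gt0P[c] : 0 < #|~: [set a; b]|.
  by rewrite cardsCs setCK card_ord cards2 ab.
rewrite !inE negb_or => /andP[ca cb].
have [|x xE] := @edge_surj2 a c; first by rewrite eq_sym.
have := E x; rewrite !inE xE !inE eqxx /= eq_sym (negPf ab).
by rewrite eq_sym (negPf cb).
Qed.

(** If [i] is in [e q] but not in [e r], an edge from [i] to another point [j] off [e r] belongs to
    the triangle of [r] and not to that of [q]. *)
Lemma triangle_inj : injective triangle.
Proof.
move=> q r E; apply: edge_inj; apply/eqP.
rewrite eqEcard !card_edge leqnn andbT.
apply/subsetP=> i iq; apply: contraT => ir.
have /card_gt0P[j] : 0 < #|~: e r :\ i|.
  have := cardsD1 i (~: e r); rewrite card_edgeC.
  by case: (i \in _) #|_ :\ _| => [] [|n].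
rewrite !inE => /andP[ji jr].
have [|x xE] := @edge_surj2 i j; first by rewrite eq_sym.
have : x \in triangle q.
  rewrite E mem_triangle xE.
  by apply/subsetP=> k; rewrite !inE => /orP[]/eqP->.
rewrite mem_triangle xE => /subsetP/(_ i).
by rewrite !inE eqxx iq => /(_ isT).
Qed.

(** The edges ab and ac together cover abc, so only the triangle on these three points contains
    both. *)
Lemma triangle_through x y a b c q :
  uniq [:: a; b; c] -> e x = [set a; b] -> e y = [set a; c] ->
  (x \in triangle q) && (y \in triangle q) = (e q == ~: [set a; b; c]).
Proof.
move=> abc xE yE; rewrite !mem_triangle xE yE -subUset.
have -> : [set a; b] :|: [set a; c] = [set a; b; c].
  by apply/setP=> i; rewrite !inE; do 3!case: (i == _).
rewrite -[RHS](inj_eq (can_inj (@setCK _))) setCK eq_sym eqEcard.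
by rewrite card_set3 // card_edgeC andbT.
Qed.

Lemma triangle_third q z a b c :
  e q = ~: [set a; b; c] -> z \in triangle q ->
  e z != [set a; b] -> e z != [set a; c] -> e z = [set b; c].
Proof.
move=> qE; rewrite mem_triangle qE setCK.
have /eqP/cards2P[i [j [ij ->]]] := card_edge z.
rewrite subUset !sub1set => /andP[iS jS] nab nac.
apply/eqP; move: iS jS nab nac ij; rewrite !inE !eq_set2.
by case/orP=> [/orP[]|] /eqP->; case/orP=> [/orP[]|] /eqP->;
  rewrite ?eqxx ?orbT.
Qed.

Lemma adj_in_triangle x y :
  adj x y -> exists q, (x \in triangle q) && (y \in triangle q).
Proof.
case/adj_edge_at=> a [b [c [abc xE yE]]].
have [|q qE] := @edge_surj (~: [set a; b; c]).
  by rewrite cardsCs setCK card_ord card_set3.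
by exists q; rewrite (triangle_through _ abc xE yE) qE.
Qed.

(** Permutations of the five points act on the labels and hence on [G]. To extend a map from [A], it
    suffices to find one permutation that induces it there. *)
Lemma aut_of_perm (A : {set G}) (h : G -> G) (p : {perm 'I_5}) :
  {in A, forall x, e (h x) = p @: e x} ->
  exists g : {perm G}, is_aut g /\ {in A, g =1 h}.
Proof.
move=> hp; have /fin_all_exists[g gE] (x : G) : exists y, e y = p @: e x.
  by apply: edge_surj; rewrite card_imset ?card_edge //; apply: perm_inj.
have g_inj : injective g.
  move=> x y gxy; apply: edge_inj; apply: (imset_inj (@perm_inj _ p)).
  by rewrite -!gE gxy.
exists (perm g_inj); split=> [x y | x xA].
  rewrite !adj_edge !permE (inj_eq g_inj) !gE; congr (_ && ~~ _).
  by rewrite -imsetI ?imset_eq0 // => ? ? _ _; apply: perm_inj.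
by apply: edge_inj; rewrite permE gE hp.
Qed.

(** In the normal form of adjacent vertices, a permutation taking [a], [b], [c] to [a'], [b'], [c']
    induces the given map. *)
Lemma K2_UH : UH (complete 2) G.
Proof.
move=> A _ h /is_copy_complete[/eqP/cards2P[x [y [xy ->]]] clA] _ _ _ hadj.
have axy := clA _ _ (set21 x y) (set22 x y) xy.
have [a [b [c [abc xE yE]]]] := adj_edge_at axy.
move: axy; rewrite -hadj ?set21 ?set22 //.
case/adj_edge_at=> a' [b' [c' [abc' hxE hyE]]].
have [//|p [pa pb pc]] := perm_extends_seq abc abc'.
apply: (@aut_of_perm _ _ p) => z; rewrite !inE => /orP[]/eqP->.
  by rewrite xE imset_set2 hxE pa pb.
by rewrite yE imset_set2 hyE pa pc.
Qed.

Lemma K4_UH : UH (complete 4) G.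
Proof.
move=> A B h /K4_copyP[a ->] /K4_copyP[a' ->] h_inj hB _.
(* h maps the edge ab to a'c for some c; take this c as the image of b. *)
pose P b c := if b == a then c = a' else
  c != a' /\ forall x, e x = [set a; b] -> e (h x) = [set a'; c].
have /fin_all_exists[s sE] (b : 'I_5) : exists c, P b c.
  rewrite /P; case: (eqVneq b a) => [_|ba]; first by exists a'.
  have [|x xE] := @edge_surj2 a b; first by rewrite eq_sym.
  have : h x \in star a' by rewrite -hB imset_f // inE xE set21.
  rewrite inE => /(set2_at (card_edge _))[c ca hxE]; exists c; split=> // y yE.
  by have -> : y = x by apply: edge_inj; rewrite xE.
have sa : s a = a' by have := sE a; rewrite /P eqxx.
have sP b : b != a ->
    s b != a' /\ forall x, e x = [set a; b] -> e (h x) = [set a'; s b].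
  by move=> /negPf ba; have := sE b; rewrite /P ba.
have s_inj : injective s.
  move=> b c.
  case: (eqVneq b a) => [-> | ba]; case: (eqVneq c a) => [-> | ca] //.
  - by move=> E; have [] := sP c ca; rewrite -E sa eqxx.
  - by move=> E; have [] := sP b ba; rewrite E sa eqxx.
  have [_ hb] := sP b ba; have [_ hc] := sP c ca => E.
  have [|x xE] := @edge_surj2 a b; first by rewrite eq_sym.
  have [|y yE] := @edge_surj2 a c; first by rewrite eq_sym.
  (* If [s b = s c], the map [h] sends the edges ab and ac to the same edge, so they coincide by
     injectivity on the star. *)
  have xy : x = y.
    apply: h_inj; rewrite ?inE ?xE ?yE ?set21 //.
    by apply: edge_inj; rewrite (hb _ xE) (hc _ yE) E.
  move/eqP: yE; rewrite -xy xE eq_set2 eqxx /= => /orP[/eqP // | /andP[_ ba']].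
  by rewrite ba' in ba.
apply: (@aut_of_perm _ _ (perm s_inj)) => x; rewrite inE => ax.
have [b ba xE] := set2_at (card_edge x) ax.
by rewrite xE imset_set2 !permE sa; have [_ ->] := sP b ba.
Qed.

(** Two of the three vertices fix the permutation, as for K_2; the third label is then forced to be
    bc in the source and b'c' in the target. *)
Lemma free_K3_UH : isos_extend (@free_copy (complete 3) (complete 4) G).
Proof.
move=> A B h /free_K3P[q ->] /free_K3P[r ->] h_inj hB hadj.
have /card_gt1P[x [y [xq yq xy]]] : 1 < #|triangle q| by rewrite card_triangle.
have axy := triangle_clique xq yq xy.
have [a [b [c [abc xE yE]]]] := adj_edge_at axy.
move: (axy); rewrite -hadj // => /adj_edge_at[a' [b' [c' [abc' hxE hyE]]]].
have hr z : z \in triangle q -> h z \in triangle r.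
  by move=> zq; rewrite -hB imset_f.
have /eqP qE : e q == ~: [set a; b; c].
  by rewrite -(triangle_through _ abc xE yE) xq.
have /eqP rE : e r == ~: [set a'; b'; c'].
  by rewrite -(triangle_through _ abc' hxE hyE) !hr.
have [//|p [pa pb pc]] := perm_extends_seq abc abc'.
apply: (@aut_of_perm _ _ p) => z zq.
case: (eqVneq z x) => [-> | zx]; first by rewrite xE imset_set2 hxE pa pb.
case: (eqVneq z y) => [-> | zy]; first by rewrite yE imset_set2 hyE pa pc.
have zE : e z = [set b; c].
  by apply: (triangle_third qE zq); rewrite -?xE -?yE (inj_eq edge_inj).
rewrite zE imset_set2 pb pc; apply: (triangle_third rE (hr z zq)).
  by rewrite -hxE (inj_eq edge_inj) (inj_in_eq h_inj).
by rewrite -hyE (inj_eq edge_inj) (inj_in_eq h_inj).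
Qed.

(** Adjacent vertices labelled ab and ac lie in one star, that of [a], and in one triangle, that on
    abc. The third vertex of this triangle is bc, which misses [a], so the two copies meet in
    nothing more. *)
Lemma K4_K3_unique_intersection :
  unique_intersection (complete 4) (complete 3) (complete 2) G.
Proof.
move=> M /is_copy_complete[/eqP/cards2P[x [y [xy ->]]] clM].
have axy := clM _ _ (set21 x y) (set22 x y) xy.
have [a [b [c [abc xE yE]]]] := adj_edge_at axy.
have [q /[dup] qxy] := adj_in_triangle axy.
rewrite (triangle_through _ abc xE yE) => /eqP qE.
exists (star a, triangle q); split=> [|[H K] /= []].
  split; [by apply/K4_copyP; exists a | by apply/free_K3P; exists q | ].
  have meetE : star a :&: triangle q = [set x; y].
    apply/eqP; rewrite eq_sym eqEsubset; apply/andP; split.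
      have /andP[xq yq] := qxy.
      by apply/subsetP=> z; rewrite in_setI [_ \in star a]inE => /set2P[]->;
        rewrite ?xq ?yq ?xE ?yE set21.
    apply/subsetP=> z; rewrite in_setI [_ \in star a]inE => /andP[az zq].
    rewrite !inE -!(inj_eq edge_inj) xE yE; apply: contraLR az.
    rewrite negb_or => /andP[zx zy]; rewrite (triangle_third qE zq zx zy) !inE.
    by move: abc; rewrite /= !inE => /andP[].
  by split=> //=; rewrite edges_inI meetE.
case/K4_copyP=> a1 -> /free_K3P[q1 ->] [M1 _]; congr (_, _).
  (* The centre [a1] of the star lies in both ab and ac, hence equals [a]. *)
  have := set21 x y; have := set22 x y; rewrite -M1 !inE xE yE !inE.
  case/andP=> h1 _ /andP[h2 _]; congr star; apply/eqP.
  move: h1 h2 abc; rewrite eq_sym; case/orP=> /eqP-> //; case/orP=> /eqP-> //.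
  by rewrite /= !inE eqxx andbF.
have xM : x \in triangle q1 by have := set21 x y; rewrite -M1 inE => /andP[].
have yM : y \in triangle q1 by have := set22 x y; rewrite -M1 inE => /andP[].
congr triangle; apply: edge_inj; rewrite qE; apply/esym/eqP.
by rewrite -(triangle_through _ abc xE yE) xM.
Qed.

Lemma K4_K3_coherent : coherent2_UH (complete 4) (complete 3) (complete 2) G.
Proof.
split; [split | exact: K2_UH | exact: K4_UH | exact: free_K3_UH
  | exact: K4_K3_unique_intersection].
- exact: sub_complete.
- exact/induced_is_subgraph/sub_complete.
- exact/induced_is_subgraph/sub_complete.
Qed.

(** * Counts of vertices and copies, and how the copies cover the graph *)

Lemma card_verts : #|G| = 10.
Proof.
rewrite (bij_eq_card f_bij) card_sig.
rewrite (eq_card (B := [set S : {set 'I_5} | #|S| == 2])) => [|S].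
  by rewrite card_draws card_ord.
by rewrite [RHS]inE -mem_edges_complete.
Qed.

Lemma card_K4_copies : #|[set A : {set G} | is_copy (complete 4) A]| = 5.
Proof.
rewrite -[RHS]card_ord -cardsT -(card_imset _ star_inj); apply: eq_card => A.
rewrite inE; apply/idP/imsetP=> [/K4_copyP[a ->] | [a _ ->]]; first by exists a.
by apply/K4_copyP; exists a.
Qed.

Lemma card_free_K3_copies :
  #|[set A : {set G} | free_copy (complete 3) (complete 4) A]| = 10.
Proof.
rewrite -card_verts -cardsT -(card_imset _ triangle_inj); apply: eq_card => A.
rewrite inE; apply/idP/imsetP=> [/free_K3P[q ->] | [q _ ->]]; first by exists q.
by apply/free_K3P; exists q.
Qed.

(** The stars already cover everything: adjacent vertices share an end [a], so their edge lies in
    the star of [a]. *)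
Lemma composed_of_K4_K3 : composed_of (fun A : {set G} =>
  is_copy (complete 4) A || free_copy (complete 3) (complete 4) A).
Proof.
have starP a : is_copy (complete 4) (star a) by apply/K4_copyP; exists a.
split; apply/setP=> u.
  rewrite inE; apply/bigcupP; have /eqP/cards2P[a [b [_ uE]]] := card_edge u.
  by exists (star a); rewrite ?starP // inE uE set21.
apply/bigcupP/idP=> [[A _] | ].
  rewrite !inE => /existsP[x /andP[_ /existsP[y /andP[_ xy]]]].
  by apply/existsP; exists x; rewrite inE; apply/existsP; exists y; rewrite inE.
rewrite inE => /existsP[x /andP[_ /existsP[y /and3P[_ xy uE]]]].
have [a [b [c [_ xE yE]]]] := adj_edge_at xy.
exists (star a); rewrite ?starP // inE; apply/existsP; exists x.
rewrite inE xE set21; apply/existsP; exists y.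
by rewrite inE yE set21 xy.
Qed.

(** Lines are indexed by [triangle], which is injective into the ten free triangles and so
    bijective; incidence is then nonadjacency of distinct vertices, by the definition of
    [triangle]. *)
Lemma triangle_config_iso :
  config_iso (triangle_config G) (nbhd_config (complement G)).
Proof.
apply: config_iso_sym.
have triP q : free_copy (complete 3) (complete 4) (triangle q).
  by apply/free_K3P; exists q.
exists id, (fun q => Sub (triangle q) (triP q)); split=> [|| p l].
- by exists id.
- apply: inj_card_bij => [q r /(congr1 val)|]; first exact: triangle_inj.
  rewrite [leqRHS]card_verts card_sig -card_free_K3_copies.
  by apply/eq_leq/eq_card=> A; rewrite inE.
by rewrite /= inE.
Qed.

(** The Petersen graph is cubic. Two distinct labels cover at least three of the five points, so at
    most one label is disjoint from both: two vertices have at most one common neighbour. *)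
Lemma nbhd_complement_config : is_vr_config 10 3 (nbhd_config (complement G)).
Proof.
split; try exact: card_verts.
- exact: card_triangle.
- move=> q; rewrite -(card_triangle q); apply: eq_card => x.
  by rewrite !inE; apply: (@adj_sym (complement G)).
move=> x y xy; apply/card_le1_eqP=> q r; rewrite !inE /= !compl_adj_edge.
have sub z : e x :&: e z == set0 -> e y :&: e z == set0 ->
    e z \subset ~: (e x :|: e y).
  move=> xz yz; rewrite setCU subsetI -!disjoints_subset -!setI_eq0.
  by rewrite ![e z :&: _]setIC xz.
have card2 : #|~: (e x :|: e y)| <= 2.
  rewrite cardsCs setCK card_ord cardsU !card_edge.
  have : #|e x :&: e y| < #|e x|.
    rewrite proper_card // properEneq subsetIl andbT.
    apply: contra xy => /eqP/setIidPl xy; rewrite -(inj_eq edge_inj).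
    by rewrite eqEcard xy !card_edge.
  by rewrite card_edge; case: #|_| => [|[]].
have eqC z : e z \subset ~: (e x :|: e y) -> e z = ~: (e x :|: e y).
  by move=> sz; apply/eqP; rewrite eqEcard sz card_edge.
case/andP=> xq yq /andP[xr yr]; apply: edge_inj.
by rewrite (eqC q (sub q xq yq)) (eqC r (sub r xr yr)).
Qed.

(** Triangles are cliques and every edge lies in one, so collinearity recovers the adjacency of [G]
    on the same vertices. *)
Lemma menger_triangle_config :
  @adj (menger_graph (triangle_config G)) =2 @adj G.
Proof.
move=> x y; apply/andP/idP=> [[xy] | xy].
  case/existsP=> -[A /= /free_K3P[q ->]] /andP[xq yq].
  exact: triangle_clique xq yq xy.
split; first by move: xy; rewrite adj_edge => /andP[].
have [q qxy] := adj_in_triangle xy; apply/existsP.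
have triP : free_copy (complete 3) (complete 4) (triangle q).
  by apply/free_K3P; exists q.
by exists (Sub (triangle q) triP).
Qed.

End LineGraphK5.

Import GRing.Theory.

(** * Labellings by pairs of points, in a form suited to computation *)

Section Labels.
(** Labels are ordered pairs, so that [meets] and [same_edge] express intersection and equality of
    edges by tests that [vm_compute] can evaluate. *)
Definition edge_of (p : 'I_5 * 'I_5) : {set 'I_5} := [set p.1; p.2].

Definition meets (p q : 'I_5 * 'I_5) : bool :=
  [|| p.1 == q.1, p.1 == q.2, p.2 == q.1 | p.2 == q.2].

Definition same_edge (p q : 'I_5 * 'I_5) : bool :=
  (p.1 == q.1) && (p.2 == q.2) || (p.1 == q.2) && (p.2 == q.1).

Lemma edge_ofP (p : 'I_5 * 'I_5) :
  p.1 != p.2 -> edge_of p \in edges (complete 5).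
Proof. by move=> pP; rewrite mem_edges_complete cards2 pP. Qed.

Definition edge_vertex p (pP : p.1 != p.2) : line_graph (complete 5) :=
  Sub (edge_of p) (edge_ofP pP).

Variables (T : finType) (lab : T -> 'I_5 * 'I_5).
Hypothesis labP : forall u, (lab u).1 != (lab u).2.

Definition label_vertex (u : T) : line_graph (complete 5) :=
  edge_vertex (labP u).

Lemma label_vertex_eq u v :
  (label_vertex u == label_vertex v) = same_edge (lab u) (lab v).
Proof. by rewrite -(inj_eq val_inj) /= eq_set2. Qed.

Lemma compl_adj_label_vertex u v :
  compl_adj (label_vertex u) (label_vertex v) = ~~ meets (lab u) (lab v).
Proof.
have bij_id : bijective (@id (line_graph (complete 5))) by exists id.
by rewrite (compl_adj_edge bij_id) //= disjoint_set2.
Qed.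

Lemma adj_label_vertex u v : adj (label_vertex u) (label_vertex v)
  = ~~ same_edge (lab u) (lab v) && meets (lab u) (lab v).
Proof.
by rewrite -label_vertex_eq /= /line_adj -[meets _ _]negbK -disjoint_set2.
Qed.

Hypothesis lab_inj : forall u v, same_edge (lab u) (lab v) -> u = v.

Lemma label_vertex_bij : #|T| = 10 -> bijective label_vertex.
Proof.
move=> cT; apply: inj_card_bij => [u v /eqP|].
  by rewrite label_vertex_eq => /lab_inj.
have bij_id : bijective (@id (line_graph (complete 5))) by exists id.
by rewrite (card_verts bij_id) cT.
Qed.
End Labels.

(** With an exhaustive explicit list, a universal statement becomes one boolean computation. *)
Lemma all_mem (T : eqType) (s : seq T) (P : pred T) :
  (forall x, x \in s) -> all P s -> forall x, P x.
Proof. by move=> sP /allP Ps x; apply: Ps. Qed.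

Lemma all2_mem (T U : eqType) (s : seq T) (t : seq U) (P : T -> U -> bool) :
  (forall x, x \in s) -> (forall y, y \in t) ->
  all (fun x => all (P x) t) s -> forall x y, P x y.
Proof. by move=> sP tP /allP Pst x y; apply: (allP (Pst x (sP x))). Qed.

Local Open Scope ring_scope.

Definition seq_Z5 : seq 'Z_5 := [:: 0; 1; 2; 3; 4].

Lemma mem_seq_Z5 x : x \in seq_Z5.
Proof. by case: x => [[|[|[|[|[|]]]]]]. Qed.

(** * The Petersen graph as the complement of L(K_5) *)

Definition petersen_verts : seq (bool * 'Z_5) :=
  [seq (b, x) | b <- [:: false; true], x <- seq_Z5].

Lemma mem_petersen_verts u : u \in petersen_verts.
Proof. by case: u => b x; apply: allpairs_f; [case: b | apply: mem_seq_Z5]. Qed.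

(** The outer pentagon carries the pairs {i, i+1}, the inner pentagram the pairs {i, i+2}. Doubling
    [u.2] makes outer neighbours disjoint: {2x, 2x+1} is followed by {2x+2, 2x+3}. *)
Definition petersen_label (u : bool * 'Z_5) : 'I_5 * 'I_5 :=
  if u.1 then (u.2 *+ 2 + 2, u.2 *+ 2 + 4) else (u.2 *+ 2, u.2 *+ 2 + 1).

Lemma petersen_iso : isomorphic (complement (line_graph (complete 5))) petersen.
Proof.
have labP u : (petersen_label u).1 != (petersen_label u).2.
  by move: u; apply: (all_mem mem_petersen_verts); vm_compute.
have lab_inj u v : same_edge (petersen_label u) (petersen_label v) -> u = v.
  move=> uv; apply/eqP; move: uv; apply/implyP; move: u v.
  by apply: (all2_mem mem_petersen_verts mem_petersen_verts); vm_compute.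
apply: isomorphic_sym; exists (label_vertex labP); split.
  by apply: label_vertex_bij; rewrite // card_prod card_bool card_ord.
move=> u v; rewrite [LHS]compl_adj_label_vertex; apply/esym/eqP; move: u v.
by apply: (all2_mem mem_petersen_verts mem_petersen_verts); vm_compute.
Qed.

(** * The classical Desargues configuration *)

Definition seq_I3 : seq 'I_3 := [:: 0; 1; 2].

Definition desargues_points : seq desargues_point :=
  Centre :: [seq h i | h <- [:: VertA; VertB; Axial], i <- seq_I3].

Definition desargues_lines : seq desargues_line :=
  Axis :: [seq h i | h <- [:: Ray; SideA; SideB], i <- seq_I3].

Lemma mem_desargues_points p : p \in desargues_points.
Proof. by case: p => // [] [[|[|[|]]]]. Qed.

Lemma mem_desargues_lines l : l \in desargues_lines.
Proof. by case: l => // [] [[|[|[|]]]]. Qed.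

Definition space_point (i : 'I_3) : 'I_5 := @widen_ord 3 5 isT i.

(* Desargues' figure is the section by a plane of the ten lines and ten planes
   spanned by five points in general position in space.  A point of the figure
   is labelled by the two points that span its line, a line of the figure by
   the two points not on its plane; incidence is then disjointness. *)
Definition point_label (p : desargues_point) : 'I_5 * 'I_5 :=
  match p with
  | Centre => (inZp 3, inZp 4)
  | VertA i => (space_point i, inZp 3)
  | VertB i => (space_point i, inZp 4)
  | Axial i => (space_point (i + 1), space_point (i + 2))
  end.

Definition line_label (l : desargues_line) : 'I_5 * 'I_5 :=
  match l with
  | Axis => (inZp 3, inZp 4)
  | Ray i => (space_point (i + 1), space_point (i + 2))
  | SideA i => (space_point i, inZp 4)
  | SideB i => (space_point i, inZp 3)
  end.

(** The point labels and the line labels each run once through the ten edges of K_5, and incidence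
    is checked to be disjointness. *)
Lemma desargues_config_iso :
  config_iso (nbhd_config (complement (line_graph (complete 5))))
    desargues_config.
Proof.
have labP p : (point_label p).1 != (point_label p).2.
  by move: p; apply: (all_mem mem_desargues_points); vm_compute.
have labL l : (line_label l).1 != (line_label l).2.
  by move: l; apply: (all_mem mem_desargues_lines); vm_compute.
have injP p q : same_edge (point_label p) (point_label q) -> p = q.
  move=> pq; apply/eqP; move: pq; apply/implyP; move: p q.
  by apply: (all2_mem mem_desargues_points mem_desargues_points); vm_compute.
have injL l m : same_edge (line_label l) (line_label m) -> l = m.
  move=> lm; apply/eqP; move: lm; apply/implyP; move: l m.
  by apply: (all2_mem mem_desargues_lines mem_desargues_lines); vm_compute.
have cP : #|point desargues_config| = 10%N.
  rewrite (bij_eq_card (f := code_point)) ?card_sum ?card_unit ?card_ord //.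
  by exists decode_point; [exact: code_pointK | by case=> [[[[]|?]|?]|?]].
have cL : #|line desargues_config| = 10%N.
  rewrite (bij_eq_card (f := code_line)) ?card_sum ?card_unit ?card_ord //.
  by exists decode_line; [exact: code_lineK | by case=> [[[[]|?]|?]|?]].
apply: config_iso_sym; exists (label_vertex labP), (label_vertex labL).
split; try exact: label_vertex_bij.
move=> p l; apply: etrans (_ : ~~ meets (point_label p) (line_label l) = _).
  have bij_id : bijective (@id (line_graph (complete 5))) by exists id.
  by rewrite /= (compl_adj_edge bij_id) //= disjoint_set2.
apply/eqP; move: p l.
by apply: (all2_mem mem_desargues_points mem_desargues_lines); vm_compute.
Qed.

(** * The Desargues graph and Y(D) in terms of labels *)

Definition dverts : seq dvert :=
  [seq (x, i) | x <- seq_Z5, i <- [:: 0; 1; 2; 3]].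

Lemma mem_dverts u : u \in dverts.
Proof.
case: u => x [i ltn_i4]; apply: allpairs_f; first exact: mem_seq_Z5.
by case: i ltn_i4 => [|[|[|[|]]]].
Qed.

(** The labelling is equivariant under the shift of x. Pairs at distance 1 in the pentagon label x_0
    and x_3, pairs at distance 2 label x_1 and x_2, so each parity class of indices carries every
    pair once. *)
Definition dlabel (u : dvert) : 'I_5 * 'I_5 :=
  match val u.2 with
  | 0%N => (u.1, u.1 + 1)
  | 1%N => (u.1 + 2, u.1 + 4)
  | 2%N => (u.1 + 1, u.1 + 3)
  | _ => (u.1 + 4, u.1)
  end.

Definition side (u : dvert) : bool := odd u.2.

Lemma dlabel_proper u : (dlabel u).1 != (dlabel u).2.
Proof. by move: u; apply: (all_mem mem_dverts); vm_compute. Qed.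

Lemma dlabel_inj u v :
  side u = side v -> same_edge (dlabel u) (dlabel v) -> u = v.
Proof.
move=> /eqP sideuv uv; apply/eqP.
move: uv; apply/implyP; move: sideuv; apply/implyP.
by move: u v; apply: (all2_mem mem_dverts mem_dverts); vm_compute.
Qed.

Lemma dlabel_desargues u v : desargues_adj u v
  = (side u != side v) && ~~ meets (dlabel u) (dlabel v).
Proof.
apply/eqP; move: u v.
by apply: (all2_mem mem_dverts mem_dverts); vm_compute.
Qed.

(* [vm_compute] evaluates both arguments of [&&]; the conditional spares it the
   inner loop for most c. *)
Lemma Y_adjE u v : Y_adj u v = has (fun c =>
  if square_arc c u v then has (fun d => cohere c d u v) hexagons else false)
  hexagons.
Proof.
apply: eq_has => c; case: ifP => // uv.
by apply/negbTE/hasP=> -[d _]; rewrite /cohere uv andbF.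
Qed.

Lemma dlabel_Y u v : Y_adj u v = [&& side u == side v,
  ~~ same_edge (dlabel u) (dlabel v) & meets (dlabel u) (dlabel v)].
Proof.
rewrite Y_adjE; apply/eqP; move: u v.
by apply: (all2_mem mem_dverts mem_dverts); vm_compute.
Qed.

(** Vertices of even index are taken as points and those of odd index as lines. *)
Lemma desargues_levi_iso : isomorphic
  (levi_graph (nbhd_config (complement (line_graph (complete 5)))))
  desargues_graph.
Proof.
pose L := line_graph (complete 5); pose g := label_vertex dlabel_proper.
have bij_id : bijective (@id L) by exists id.
apply: isomorphic_sym.
exists (fun u : dvert => if side u then inr (g u) else inl (g u) : L + L).
split.
  apply: inj_card_bij => [u v | ]; last first.
    by rewrite card_sum (card_verts bij_id) // card_prod !card_ord.
  (* Each label occurs on both sides, so [g] is injective only within a side. *)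
  have g_inj : side u = side v -> g u = g v -> u = v.
    by move=> uv /eqP; rewrite label_vertex_eq; apply: dlabel_inj.
  by case: (side u) g_inj; case: (side v) => // g_inj E;
    apply: g_inj; rewrite //; [apply: inr_inj E | apply: inl_inj E].
move=> u v; rewrite [RHS]dlabel_desargues.
by case: (side u); case: (side v) => //=;
  rewrite ?[compl_adj (g v) _](@adj_sym (complement L));
  apply: compl_adj_label_vertex.
Qed.

(** * The two components of Y(D) *)

Lemma sideE u : side u = (u.2 == 1) || (u.2 == 3).
Proof. by apply/eqP; move: u; apply: (all_mem mem_dverts); vm_compute. Qed.

Lemma sideNE u : ~~ side u = (u.2 == 0) || (u.2 == 2).
Proof. by apply/eqP; move: u; apply: (all_mem mem_dverts); vm_compute. Qed.

Lemma side_verts_iso (S : {set Y_graph}) (b : bool) (i j : 'I_4) :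
  i != j -> (forall u : dvert, u \in S = (u.2 == i) || (u.2 == j)) ->
  (forall u : dvert, u \in S -> side u = b) ->
  isomorphic (induced S) (line_graph (complete 5)).
Proof.
move=> ij SE sideS.
have labP (u : induced S) := dlabel_proper (val u).
exists (label_vertex labP); split.
  apply: label_vertex_bij => [u v uv|].
    by apply/val_inj/dlabel_inj; rewrite // !sideS ?(valP u) ?(valP v).
  rewrite card_sig (eq_card (B := setX [set: 'Z_5] [set i; j])) => [|u].
    by rewrite cardsX cardsT card_ord cards2 ij.
  by rewrite !inE /= [LHS]SE.
move=> u v; rewrite adj_label_vertex [RHS]dlabel_Y.
by rewrite !sideS ?(valP u) ?(valP v) ?eqxx.
Qed.

Lemma Y1_iso : isomorphic Y1 (line_graph (complete 5)).
Proof.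
apply: (@side_verts_iso Y1_verts false 0 2) => // u; rewrite inE // -sideNE.
exact: negbTE.
Qed.

Lemma Y2_iso : isomorphic Y2 (line_graph (complete 5)).
Proof.
by apply: (@side_verts_iso Y2_verts true 1 3) => // u; rewrite inE // -sideE.
Qed.

(** Adjacency in Y(D) preserves the side; conversely, each half is L(K_5), of diameter 2, so two
    steps reach a fixed vertex of that side. *)
Lemma Y_connect (u v : Y_graph) :
  connect (@adj Y_graph) u v = (side u == side v).
Proof.
apply/idP/idP=> [/connectP[p] | uv].
  elim: p u => [|w p IH] u /= => [_ -> // | /andP[uw pw] vE].
  rewrite -(eqP (IH w pw vE)).
  by have := uw : Y_adj u w; rewrite dlabel_Y => /andP[].
(* Adjacency is replaced by its description through labels, which is cheap to compute; allowing
   equality covers walks shorter than two. *)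
pose near x y := (x == y) || [&& side x == side y,
  ~~ same_edge (dlabel x) (dlabel y) & meets (dlabel x) (dlabel y)].
have nearP x y : near x y -> connect (@adj Y_graph) x y.
  by case/orP=> [/eqP-> // | xy]; apply: connect1; rewrite /= dlabel_Y.
pose base b : dvert := (0, if b then 1 else 0).
have to_base x : connect (@adj Y_graph) x (base (side x)).
  have : has (fun w => near x w && near w (base (side x))) dverts.
    by move: x; apply: (all_mem mem_dverts); vm_compute.
  by case/hasP=> w _ /andP[/nearP xw /nearP]; apply: connect_trans.
apply: connect_trans (to_base u) _; rewrite (eqP uv).
by rewrite (sym_connect_sym (@adj_sym Y_graph)).
Qed.

Lemma Y_components : components Y_graph = [set Y1_verts; Y2_verts].
Proof.
have cls (u : Y_graph) : [set v in [set: Y_graph] | connect (@adj Y_graph) u v]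
    = if side u then Y2_verts else Y1_verts.
  apply/setP=> v; rewrite !inE Y_connect eq_sym.
  by case: (side u); rewrite inE -?sideE -?sideNE; case: (side v).
apply/setP=> S; rewrite /components /equivalence_partition !inE.
apply/imsetP/orP=> [[u _ ->] | [] /eqP->].
- by rewrite cls; case: (side u); rewrite eqxx; [right | left].
- by exists ((0, 0) : dvert); rewrite ?inE // cls.
- by exists ((0, 1) : dvert); rewrite ?inE // cls.
Qed.

Local Close Scope ring_scope.

Theorem theorem3 :
  components Y_graph = [set Y1_verts; Y2_verts] /\
  (forall G : sgraph, G = Y1 \/ G = Y2 ->
    [/\ coherent2_UH (complete 4) (complete 3) (complete 2) G,
        #|[set A : {set G} | is_copy (complete 4) A]| = 5,
        #|[set A : {set G} | free_copy (complete 3) (complete 4) A]| = 10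
      & composed_of (fun A : {set G} =>
          is_copy (complete 4) A || free_copy (complete 3) (complete 4) A)]) /\
  (forall G : sgraph, G = Y1 \/ G = Y2 ->
    [/\ is_vr_config 10 3 (triangle_config G),
        self_dual (triangle_config G),
        config_iso (triangle_config G) desargues_config
      & isomorphic (levi_graph (triangle_config G)) desargues_graph] /\
    [/\ @adj (menger_graph (triangle_config G)) =2 @adj G,
        isomorphic (menger_graph (triangle_config G)) Y1
      & isomorphic (menger_graph (triangle_config G)) Y2]) /\
  (forall G : sgraph, G = Y1 \/ G = Y2 ->
    isomorphic G (line_graph (complete 5))) /\
  isomorphic (complement (line_graph (complete 5))) petersen.
Proof.
have GL G : G = Y1 \/ G = Y2 -> isomorphic G (line_graph (complete 5)).
  by case=> ->; [apply: Y1_iso | apply: Y2_iso].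
split; first exact: Y_components.
split=> [G /GL[f [bf fE]] | ].
  split; first exact: (K4_K3_coherent bf fE).
  - exact: (card_K4_copies bf fE).
  - exact: (card_free_K3_copies bf fE).
  - exact: (composed_of_K4_K3 bf fE).
split; last by split; [exact: GL | exact: petersen_iso].
move=> G /GL /[dup] isoG [f [bf fE]].
have triG := triangle_config_iso bf fE.
(* The passage to the fixed graph L(K_5) makes one comparison with the Desargues configuration, and
   one with its Levi graph, serve for both halves. *)
have hub :=
  config_iso_trans triG (nbhd_config_iso (isomorphic_complement isoG)).
have menger := menger_triangle_config bf fE.
(* The Menger graph has the vertices and adjacency of [G], so [f] itself is an isomorphism onto
   L(K_5), through which both halves are reached. *)
have mengerL :
    isomorphic (menger_graph (triangle_config G)) (line_graph (complete 5)).
  by exists f; split=> // x y; rewrite menger.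
split; split=> //.
- apply: is_vr_config_iso (config_iso_sym triG) _.
  exact: (nbhd_complement_config bf fE).
- exact: self_dual_iso triG (nbhd_config_self_dual _).
- exact: config_iso_trans hub desargues_config_iso.
- exact: isomorphic_trans (levi_graph_iso hub) desargues_levi_iso.
- exact: isomorphic_trans mengerL (isomorphic_sym Y1_iso).
- exact: isomorphic_trans mengerL (isomorphic_sym Y2_iso).
Qed.
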